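(* Let $\mathcal{E}_{\mathrm P}=\{p_\theta:\theta\in\Theta\}$ be a discrete exponential family on $\mathbb{R}^k$ with base measure $\nu$ and convex support $\mathrm P$ satisfying assumptions (A1)-(A4) of the context. Let $\theta\in\Theta$, $d\in\mathbb{R}^k$, let $\{\rho_n\}$ be a sequence of non-negative numbers tending to infinity, and suppose $\theta_n=\theta+\rho_n d\in\Theta$ for all $n$. Put $\mu_n=\mathbb{E}_{\theta_n}[X]$. 1. For every face $F$ of $\mathrm P$: one has $p_{\theta_n}\to p^F_{\theta_F}$ $\nu$-a.e. and $\mu_n\to\mu^F\in\mathrm{relint}(F)$ if and only if $d\in\mathrm{relint}(N_F)$. Here $\mu^F$ is the mean of the distribution with $\nu_F$-density $p^F_{\theta_F}$. 2. If $d\notin\bigcup_G N_G$, the union being over all faces $G$ of $\mathrm P$, then $\|\mu_n\|_2\to\infty$.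
   Context: Setting. $\nu$ is a measure on $\mathbb{R}^k$ concentrated on its support $\mathrm{supp}(\nu)=$ closure of $\{x:\nu(\{x\})>0\}$. The convex support $\mathrm P$ is the closure of the convex hull of $\mathrm{supp}(\nu)$. The densities with respect to $\nu$ are $p_\theta(x)=\exp\{\langle x,\theta\rangle-\psi(\theta)\}$, $\psi(\theta)=\log\int e^{\langle x,\theta\rangle}d\nu(x)$, $\theta\in\Theta$, where $\emptyset\ne\Theta\subseteq\{\theta\in\mathbb{R}^k:\int e^{\langle x,\theta\rangle}d\nu(x)<\infty\}$. $\mathbb{E}_\theta[X]=\int z\,p_\theta(z)\,d\nu(z)$. Assumptions. (A1) $\mathrm{supp}(\nu)$ is countable. (A2) $\mathrm P$ is a full-dimensional polyhedron in $\mathbb{R}^k$. (A3) Every face $F$ of $\mathrm P$ satisfies $F=\mathrm{convhull}(S_F)$ for some set $S_F$ of points $x$ with $\nu(\{x\})>0$. (A4) $\Theta$ is open. Faces are nonempty; $\mathrm P$ is regarded as the improper face of itself. $\mathrm{relint}$ denotes relative interior. For a face $F$, $\nu_F$ is the restriction of $\nu$ to $F$, and $p^F_\theta(x)=\exp\{\langle x,\theta\rangle-\psi^F(\theta)\}$ for $x\in F$, $p^F_\theta(x)=0$ for $x\notin F$, where $\psi^F(\theta)=\log\int e^{\langle x,\theta\rangle}d\nu_F(x)$. With $\theta_F=\{\theta+\zeta\in\Theta:\zeta\in\mathrm{lin}(N_F)\}$, the function $p^F_\theta$ depends ($\nu$-a.e.) only on the class $\theta_F$ and is written $p^F_{\theta_F}$.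 Normal cone: $N_F=\{c\in\mathbb{R}^k: F\subseteq\{x\in\mathrm P:\langle c,x\rangle=\max_{y\in\mathrm P}\langle c,y\rangle\}\}$. $\mathrm{lin}(N_F)$ is the linear span of $N_F$. *)

(* Defs.v *)
From HB Require Import structures.
From mathcomp Require Import all_boot all_order all_algebra.
From mathcomp Require Import all_classical all_reals all_analysis.
From mathcomp Require Import measurable_realfun.

Set Implicit Arguments.
Unset Strict Implicit.
Unset Printing Implicit Defensive.

Import Order.TTheory GRing.Theory Num.Theory.
Import numFieldNormedType.Exports.

Local Open Scope classical_set_scope.
Local Open Scope ring_scope.

(* R^k as a measurable space: the row vectors 'rV[R]_k with the Borel
   sigma-algebra; as a bare type it is convertible to 'rV[R]_k. *)
Notation borel_rV R k := (g_sigma_algebraType (@open 'rV[R]_k)).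

Section ConvexGeometry.
Context {R : realType} {k : nat}.
Local Notation V := 'rV[R]_k.
Implicit Types (x y c : V) (A S P F : set V).

Definition dot x y : R := \sum_(i < k) x 0 i * y 0 i.

(* The norm `|x| of 'rV[R]_k in the library is the maximum norm. *)
Definition norm2 x : R := Num.sqrt (dot x x).

Definition conv_hull S : set V := smallest (@convex_set R V) S.

Definition aff_hull S : set V :=
  [set y | exists (m : nat) (a : 'I_m -> R) (x : 'I_m -> V),
    [/\ forall i, S (x i), \sum_(i < m) a i = 1 & y = \sum_(i < m) a i *: x i]].

Definition lin_span S : set V :=
  [set y | exists (m : nat) (a : 'I_m -> R) (x : 'I_m -> V),
    (forall i, S (x i)) /\ y = \sum_(i < m) a i *: x i].

Definition relint A : set V :=
  [set x | A x /\ \forall y \near x, aff_hull A y -> A y].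

Definition polyhedron P : Prop :=
  exists (m : nat) (a : 'I_m -> V) (b : 'I_m -> R),
    P = [set x | forall i, dot (a i) x <= b i].

Definition full_dimensional P : Prop := aff_hull P = setT.

(* {x in P : <c,x> = max_(y in P) <c,y>}; empty when the maximum is not
   attained. *)
Definition argmax P c : set V :=
  [set x | P x /\ forall y, P y -> dot c y <= dot c x].

(* The choice c = 0 makes P itself a face as soon as it is nonempty. *)
Definition face P F : Prop := F !=set0 /\ exists c, F = argmax P c.

Definition normal_cone P F : set V := [set c | F `<=` argmax P c].

End ConvexGeometry.

Section ExponentialFamily.
Context {R : realType} {k : nat}.
Local Notation V := 'rV[R]_k.
Variable nu : {measure set (borel_rV R k) -> \bar R}.
Implicit Types (x theta : V) (F : set V).

Definition atoms : set V := [set x | (0 < nu [set x])%E].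

Definition supp : set V := closure atoms.

Definition convex_support : set V := closure (conv_hull supp).

Definition natural_params : set V :=
  [set theta | (\int[nu]_x (expR (dot (x : V) theta))%:E < +oo)%E].

Definition log_partition theta : R :=
  ln (\int[nu]_x expR (dot (x : V) theta)).

Definition density theta x : R := expR (dot x theta - log_partition theta).

Definition mean theta : V :=
  \row_i \int[nu]_x ((x : V) 0 i * density theta x).

(* Integrals against the restriction nu_F are integrals of nu over F. *)
Definition face_log_partition F theta : R :=
  ln (\int[nu]_(x in F) expR (dot (x : V) theta)).

Definition face_density F theta x : R :=
  if x \in F then expR (dot x theta - face_log_partition F theta) else 0.

Definition face_mean F theta : V :=
  \row_i \int[nu]_(x in F) ((x : V) 0 i * face_density F theta x).

Definition face_class (Theta : set V) F theta : set V :=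
  [set theta' | Theta theta' /\
     lin_span (normal_cone convex_support F) (theta' - theta)].

End ExponentialFamily.

(* Well-definedness of the density indexed by the class of theta: the values
   of face_density do not depend on the representative. *)
Section FaceClass.
Context {R : realType} {k : nat}.
Local Notation V := 'rV[R]_k.

Lemma dotC (x y : V) : dot x y = dot y x.
Proof. by apply: eq_bigr => i _; rewrite mulrC. Qed.

Lemma dotDr (x y z : V) : dot x (y + z) = dot x y + dot x z.
Proof. by rewrite -big_split; apply: eq_bigr => i _; rewrite mxE mulrDr. Qed.

Lemma dot_sumr (x : V) m (a : 'I_m -> R) (z : 'I_m -> V) :
  dot x (\sum_(i < m) a i *: z i) = \sum_(i < m) a i * dot x (z i).
Proof.
under [RHS]eq_bigr do rewrite mulr_sumr.
rewrite exchange_big; apply: eq_bigr => j _ /=.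
rewrite summxE mulr_sumr; apply: eq_bigr => i _.
by rewrite mxE mulrCA.
Qed.

Lemma lin_span_normal_cone_dot (P F : set V) (z x y : V) :
  lin_span (normal_cone P F) z -> F x -> F y -> dot x z = dot y z.
Proof.
move=> [m [a [c [Nc ->]]]] Fx Fy; rewrite !dot_sumr.
apply: eq_bigr => i _; congr (_ * _); rewrite ![dot _ (c i)]dotC.
have [[Px mx] [Py my]] := (Nc i x Fx, Nc i y Fy).
by apply/eqP; rewrite eq_le mx ?my.
Qed.

Lemma measurable_dot (theta : V) :
  measurable_fun [set: borel_rV R k] (fun x => dot (x : V) theta).
Proof.
move=> mT; apply: (measurability _ (RGenOInfty.measurableE R)) => //.
move=> _ [_ [r ->] <-]; rewrite setTI; apply: sub_sigma_algebra.
have cf : continuous (fun x : V => dot x theta).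
  apply: (@continuous_big R 'I_k +%R 0 xpredT) => [|i _ x].
    exact: add_continuous.
  apply: (@cvgMr_tmp _ _ (nbhs x) (nbhs_filter x)); exact: coord_continuous.
by move/continuousP: cf; apply; exact: itv_open_ends_open.
Qed.

Lemma face_density_class (nu : {measure set (borel_rV R k) -> \bar R})
    (Theta F : set V) (theta theta' : V) :
  (measurable : set (set (borel_rV R k))) F ->
  0 < \int[nu]_(x in F) expR (dot (x : V) theta) ->
  face_class nu Theta F theta theta' ->
  face_density nu F theta' =1 face_density nu F theta.
Proof.
move=> mF I0 [_ Nz] x; rewrite /face_density.
have [xF|//] := boolP (x \in F).
have Fx : F x by exact: set_mem xF.
set z := theta' - theta in Nz.
have zE y : F y -> dot y theta' = dot x z + dot y theta.
  move=> Fy; rewrite (lin_span_normal_cone_dot Nz Fx Fy) -dotDr.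
  by rewrite /z subrK.
have IE : (\int[nu]_(y in F) (expR (dot (y : V) theta'))%:E =
    (expR (dot x z))%:E * \int[nu]_(y in F) (expR (dot (y : V) theta))%:E)%E.
  rewrite -ge0_integralZl//.
  - by apply: eq_integral => y /set_mem /zE ->; rewrite expRD.
  - apply/measurable_EFinP; apply: measurableT_comp => //.
    exact: measurable_funTS (measurable_dot theta).
have -> : face_log_partition nu F theta' =
    dot x z + face_log_partition nu F theta.
  rewrite /face_log_partition -[dot x z in RHS]expRK -lnM ?posrE ?expR_gt0//.
  congr ln; rewrite /Rintegral IE; move: I0; rewrite /Rintegral.
  by case: (integral _ _ _) => [r| |]; rewrite ?ltxx.
by rewrite zE// opprD addrACA subrr add0r.
Qed.

End FaceClass.

(* Main.v *)
(* For d in relint(N_F) one has F = argmax_P <., d>; after factoring out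
   e^(rho M), M = max_P <., d>, the exponential weights decrease to their
   restriction to F, so dominated convergence (domination comes from theta
   being interior to Theta) gives the limits of densities and means, and the
   limit mean satisfies strictly every inequality of P that is strict at some
   atom of F. Conversely, if <., d> is bounded on P, it is maximal on a face G;
   the same computation identifies the limit of the densities as that of G, so
   F and G have the same atoms, hence F = G by (A3), and Farkas' lemma gives
   d in relint(N_G). If <., d> is unbounded on P then E[<X, d>] tends to
   infinity. Assumption (A3) provides atoms beyond every level of <., d>. *)
Require Import Defs.
From HB Require Import structures.
From mathcomp Require Import all_boot all_order all_algebra.
From mathcomp Require Import all_classical all_reals all_analysis.
From mathcomp Require Import measurable_realfun ring lra.
Import Order.TTheory GRing.Theory Num.Theory.
Import numFieldNormedType.Exports.
Local Open Scope classical_set_scope.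
Local Open Scope ring_scope.

(** * Algebra, order and continuity of the inner product *)

Section Dot.
Set Implicit Arguments.
Unset Strict Implicit.
Context {R : realType} {k : nat}.
Local Notation V := 'rV[R]_k.
Implicit Types x y z a : V.

Lemma dotDl x y z : dot (x + y) z = dot x z + dot y z.
Proof. by rewrite !(dotC _ z) dotDr. Qed.

Lemma dotZr (s : R) x y : dot x (s *: y) = s * dot x y.
Proof. by rewrite mulr_sumr; apply: eq_bigr => i _; rewrite mxE mulrCA. Qed.

Lemma dotZl (s : R) x y : dot (s *: x) y = s * dot x y.
Proof. by rewrite dotC dotZr dotC. Qed.

Lemma dotNr x y : dot x (- y) = - dot x y.
Proof. by rewrite -scaleN1r dotZr mulN1r. Qed.

Lemma dotNl x y : dot (- x) y = - dot x y.
Proof. by rewrite dotC dotNr dotC. Qed.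

Lemma dotBr x y z : dot x (y - z) = dot x y - dot x z.
Proof. by rewrite dotDr dotNr. Qed.

Lemma dotBl x y z : dot (x - y) z = dot x z - dot y z.
Proof. by rewrite dotDl dotNl. Qed.

Lemma dot0l y : dot 0 y = 0.
Proof. by rewrite -(scale0r 0) dotZl mul0r. Qed.

Lemma dot_suml m (s : 'I_m -> R) (z : 'I_m -> V) x :
  dot (\sum_(i < m) s i *: z i) x = \sum_(i < m) s i * dot (z i) x.
Proof. by rewrite dotC dot_sumr; apply: eq_bigr => i _; rewrite dotC. Qed.

Lemma dot_ge0 x : 0 <= dot x x.
Proof. by apply: sumr_ge0 => i _; rewrite -expr2 sqr_ge0. Qed.

Lemma dot_eq0 x : (dot x x == 0) = (x == 0).
Proof.
apply/idP/eqP => [|->]; last by rewrite dot0l.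
rewrite psumr_eq0 => [/allP xx0|i _]; last by rewrite -expr2 sqr_ge0.
apply/rowP => i; have := xx0 i (mem_index_enum _).
by rewrite -expr2 sqrf_eq0 mxE => /eqP.
Qed.

Lemma dot_delta i x : dot x (delta_mx 0 i) = x 0 i.
Proof.
rewrite /dot (bigD1 i)//= big1 => [|j /negPf ji]; rewrite mxE eqxx/=.
  by rewrite eqxx mulr1 addr0.
by rewrite ji mulr0.
Qed.

(** Every coordinate of [y] is at most [norm2 y] in absolute value. This crude constant suffices to
    turn divergence of a linear functional into divergence of the Euclidean norm. *)
Lemma ler_dot_norm2 x y : dot x y <= (\sum_i `|x 0 i|) * norm2 y.
Proof.
rewrite /dot mulr_suml; apply: ler_sum => i _.
rewrite (le_trans (ler_norm _))// normrM ler_wpM2l// -sqrtr_sqr.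
rewrite /norm2 ler_sqrt ?dot_ge0// /dot (bigD1 i)//= -expr2 lerDl.
by apply: sumr_ge0 => j _; rewrite -expr2 sqr_ge0.
Qed.

Lemma continuous_dot a : continuous (fun x : V => dot x a).
Proof.
apply: (@continuous_big R 'I_k +%R 0 xpredT) => [|i _ x].
  exact: add_continuous.
by apply: (@cvgMr_tmp _ _ (nbhs x) (nbhs_filter x)); exact: coord_continuous.
Qed.

Lemma near_ltr_dot a (x : V) (b : R) :
  dot a x < b -> \forall y \near x, dot a y < b.
Proof.
rewrite dotC => axb; have := @continuous_dot a x.
move/(@cvgr_lt _ _ _ _ _ (dot x a)) => /(_ b axb).
by apply: filterS => y; rewrite dotC.
Qed.

Lemma closed_dot_le a (b : R) : closed [set x : V | dot a x <= b].
Proof.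
rewrite (_ : mkset _ = (fun x => dot x a) @^-1` [set t | t <= b]); last first.
  by apply/seteqP; split => x /=; rewrite dotC.
apply: closed_comp => [x _|]; first exact: continuous_dot.
exact: closed_le.
Qed.

Lemma convex_dot_le a (b : R) : convex_set [set x : V | dot a x <= b].
Proof.
apply/convex_setW => x y; rewrite !inE/= => xb yb l l0 l1.
have l0' : 0 <= 1 - l%:num :> R by rewrite subr_ge0 ltW.
apply/mem_set.
change (dot a (l%:num *: (x : V) + (1 - l%:num) *: (y : V)) <= b).
by rewrite dotDr !dotZr; nra.
Qed.

End Dot.

(** * Farkas' lemma *)

Section Farkas.
Set Implicit Arguments.
Unset Strict Implicit.
Context {R : realType}.

(* Bartl's induction on the number of vectors: if some [z0] satisfies all but
   the last inequality and violates the conclusion, then it violates the last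
   inequality, and the others can be projected along it onto [z0^perp]. *)
Lemma farkas_cone k m (a : 'I_m -> 'rV[R]_k) (c : 'rV[R]_k) :
  (forall z, (forall i, dot (a i) z <= 0) -> dot c z <= 0) ->
  exists2 s : 'I_m -> R, forall i, 0 <= s i & c = \sum_(i < m) s i *: a i.
Proof.
elim: m a c => [|m IH] a c ac.
  exists (fun=> 0) => //; rewrite big_ord0; apply/eqP; rewrite -dot_eq0.
  by rewrite eq_le dot_ge0 andbT; apply: ac => -[].
pose al := a ord_max.
pose aw i := a (widen_ord (leqnSn m) i).
have split_ord z : (forall i, dot (aw i) z <= 0) -> dot al z <= 0 ->
    forall i, dot (a i) z <= 0.
  move=> wz lz i; have [im|mi] := ltnP i m.
    have := wz (Ordinal im); rewrite /aw; congr (dot (a _) _ <= _).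
    exact: val_inj.
  suff -> : i = ord_max by [].
  by apply: val_inj; apply/eqP; rewrite eqn_leq mi -ltnS ltn_ord.
have [wc|/existsNP[z0 /not_implyP[wz0 /negP]]] :=
    pselect (forall z, (forall i, dot (aw i) z <= 0) -> dot c z <= 0).
  have [s s0 ->] := IH aw c wc.
  exists (fun i => oapp s 0 (insub (val i))) => [i|].
    by case: insubP => //= j _ _; exact: s0.
  rewrite big_ord_recr/= insubF ?ltnn// scale0r addr0.
  apply: eq_bigr => i _; congr (_ *: _).
  by rewrite insubT//= => im; congr s; exact: val_inj.
rewrite -ltNge => cz0.
have lz0 : 0 < dot al z0.
  rewrite ltNge; apply/negP => lz0; move: cz0; rewrite ltNge ac//.
  exact: split_ord.
pose pr (b : 'rV[R]_k) := b - (dot b z0 / dot al z0) *: al.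
have [z wz|s s0 /eqP cE] := IH (pr \o aw) (pr c).
  have prE b : dot (pr b) z = dot b (z - (dot al z / dot al z0) *: z0).
    by rewrite /pr dotBl dotZl dotBr dotZr; ring.
  rewrite prE; apply: ac; apply: split_ord => [i|].
    by rewrite -prE; exact: wz.
  by rewrite dotBr dotZr divfK ?subrr ?gt_eqF.
(* Undoing the projections collects all multiples of [al] into this one coefficient. It is
   nonnegative because [dot c z0 > 0] while every [dot (aw i) z0 <= 0]. *)
pose t := dot c z0 / dot al z0 - \sum_(i < m) s i * (dot (aw i) z0 / dot al z0).
exists (fun i => oapp s t (insub (val i))) => [i|].
  case: insubP => /= [j _ _|_]; first exact: s0.
  rewrite subr_ge0 (@le_trans _ _ 0)//; last by rewrite divr_ge0// ltW.
  apply: sumr_le0 => j _; rewrite mulr_ge0_le0 ?s0//.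
  by rewrite mulr_le0_ge0 ?invr_ge0 ?(ltW lz0)//.
rewrite big_ord_recr/= insubF ?ltnn//= /t scalerBl.
have -> : \sum_(i < m) oapp s t (insub (val i)) *: a (widen_ord (leqnSn m) i) =
    \sum_(i < m) s i *: aw i.
  apply: eq_bigr => i _; congr (_ *: _).
  by rewrite insubT//= => im; congr s; exact: val_inj.
move: cE; rewrite /pr subr_eq => /eqP cE; rewrite [LHS]cE.
rewrite addrCA addrC; congr (_ + _).
rewrite scaler_suml -sumrB; apply: eq_bigr => i _.
by rewrite /= scalerBr scalerA.
Qed.

Lemma farkas_cone_fin k (I : finType) (a : I -> 'rV[R]_k) (c : 'rV[R]_k) :
  (forall z, (forall i, dot (a i) z <= 0) -> dot c z <= 0) ->
  exists2 s : I -> R, forall i, 0 <= s i & c = \sum_i s i *: a i.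
Proof.
move=> ac; have [z az|s s0 ->] := @farkas_cone k #|I| (a \o enum_val) c.
  by apply: ac => i; have := az (enum_rank i); rewrite /= enum_rankK.
exists (s \o enum_rank) => [i|]; first exact: s0.
rewrite [RHS](reindex (@enum_val I predT))/=; last first.
  exact/onW_bij/enum_val_bij.
by apply: eq_bigr => i _; rewrite enum_valK.
Qed.

(** The index type [I + unit] encodes a system of constraints with one more appended. *)
Lemma sum_inr_tt (U : nmodType) (I : finType) (f : I + unit -> U) :
  \sum_i f i = \sum_i f (inl i) + f (inr tt).
Proof. by rewrite big_sumType/= [X in _ + X](big_pred1 tt)// => -[]. Qed.

Lemma dot_row_mx k l (x y : 'rV[R]_k) (x' y' : 'rV[R]_l) :
  dot (row_mx x x') (row_mx y y') = dot x y + dot x' y'.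
Proof.
rewrite /dot big_split_ord/=; congr (_ + _); apply: eq_bigr => i _.
  by rewrite !row_mxEl.
by rewrite !row_mxEr.
Qed.

Lemma dot_scalar_mx (s t : R) : dot s%:M t%:M = s * t.
Proof. by rewrite /dot big_ord1 !mxE eqxx !mulr1n. Qed.

(* Allowing an empty polyhedron, with the recession hypothesis stated
   separately, lets the same lemma cover the theorem of the alternative
   ([c = 0], [M = -1]). *)
Lemma farkas_affine k (I : finType) (a : I -> 'rV[R]_k) (b : I -> R)
    (c : 'rV[R]_k) (M : R) :
  (forall x, (forall i, dot (a i) x <= b i) -> dot c x <= M) ->
  (forall z, (forall i, dot (a i) z <= 0) -> dot c z <= 0) ->
  exists s : I -> R, [/\ forall i, 0 <= s i, c = \sum_i s i *: a i
    & \sum_i s i * b i <= M].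
Proof.
(* Homogenisation: a pair [(z, t)] satisfying all the cone inequalities has [t <= 0]. If [t < 0],
   rescaling [z] by [(- t)^-1] gives a feasible point and [cM] applies; if [t = 0], [z] is a
   recession direction and [c0] applies. *)
move=> cM c0; pose a' (i : I + unit) : 'rV[R]_(k + 1) :=
  if i is inl j then row_mx (a j) (b j)%:M else row_mx 0 1%:M.
have [w aw|s s0] := farkas_cone_fin (a := a') (c := row_mx c M%:M).
  rewrite -[w]hsubmxK (mx11_scalar (rsubmx w)) in aw *.
  set z := lsubmx w in aw *; set t := rsubmx w 0 0 in aw *.
  have az i : dot (a i) z + b i * t <= 0.
    by have := aw (inl i); rewrite dot_row_mx dot_scalar_mx.
  have : t <= 0.
    by have := aw (inr tt); rewrite dot_row_mx dot_scalar_mx dot0l add0r mul1r.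
  rewrite dot_row_mx dot_scalar_mx le_eqVlt => /predU1P[t0|t0].
    rewrite t0 mulr0 addr0; apply: c0 => i.
    by have := az i; rewrite t0 mulr0 addr0.
  have tN : 0 < - t by rewrite oppr_gt0.
  have := cM ((- t)^-1 *: z); rewrite dotZr => /(_ _).
  have -> : (dot c z + M * t <= 0) = ((- t)^-1 * dot c z <= M).
    by rewrite [_^-1 * _]mulrC ler_pdivrMr// mulrN -[in RHS]subr_le0 opprK.
  apply => i; rewrite dotZr [_^-1 * _]mulrC ler_pdivrMr// mulrN.
  by rewrite -subr_le0 opprK.
rewrite sum_inr_tt/= => cE.
exists (s \o inl); split => [i||]; first exact: s0.
  have := congr1 lsubmx cE.
  rewrite linearD linear_sum/= linearZ/= !row_mxKl scaler0 addr0 => ->.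
  by apply: eq_bigr => i _; rewrite linearZ/= row_mxKl.
have := congr1 (fun w => (rsubmx w) 0 0) cE.
rewrite /= linearD linear_sum/= linearZ/= !row_mxKr.
rewrite !mxE eqxx mulr1 mulr1n => ->.
rewrite summxE [leLHS](_ : _ =
    \sum_i rsubmx (s (inl i) *: row_mx (a i) (b i)%:M) 0 0).
  by rewrite lerDl.
by apply: eq_bigr => i _; rewrite linearZ/= row_mxKr !mxE eqxx mulr1n.
Qed.

(** Given a feasible point, the recession hypothesis is automatic: a recession direction that
    increases [c] would carry [x0] past the level [M]. *)
Lemma farkas_affine_feasible k (I : finType) (a : I -> 'rV[R]_k) (b : I -> R)
    (c x0 : 'rV[R]_k) (M : R) : (forall i, dot (a i) x0 <= b i) ->
  (forall x, (forall i, dot (a i) x <= b i) -> dot c x <= M) ->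
  exists s : I -> R, [/\ forall i, 0 <= s i, c = \sum_i s i *: a i
    & \sum_i s i * b i <= M].
Proof.
move=> ax0 cM; apply: farkas_affine => // z az.
rewrite leNgt; apply/negP => cz.
pose t := (`|M - dot c x0| + 1) / dot c z.
have t0 : 0 <= t by rewrite divr_ge0 ?addr_ge0// ltW.
have : dot c (x0 + t *: z) <= M.
  by apply: cM => i; rewrite dotDr dotZr -[b i]addr0 lerD// mulr_ge0_le0.
rewrite dotDr dotZr divfK ?gt_eqF//.
by have := ler_norm (M - dot c x0); lra.
Qed.

End Farkas.

(** * Faces and normal cones of polyhedra *)

Section Polyhedron.
Set Implicit Arguments.
Unset Strict Implicit.
Context {R : realType} {k : nat}.
Local Notation V := 'rV[R]_k.
Implicit Types (x y z c d : V) (F A P : set V).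

Lemma nbhs_line A x v :
  nbhs x A -> exists2 e : R, 0 < e & forall t, `|t| < e -> A (x + t *: v).
Proof.
move=> xA; have /= : (fun t : R => x + t *: v) t @[t --> (0 : R)] --> x.
  rewrite -[X in _ --> X]addr0 -[X in _ + X](scale0r v).
  by apply: cvgD; [exact: cvg_cst|apply: cvgZr_tmp; exact: cvg_id].
move=> /(_ A xA) /nbhs_ballP[e /= e0 eA]; exists e => // t te.
by apply: eA; rewrite /ball/= sub0r normrN.
Qed.

Lemma aff_hull_dot A c (b : R) y :
  (forall x, A x -> dot c x = b) -> aff_hull A y -> dot c y = b.
Proof.
move=> cb [m [a [x [Ax a1 ->]]]]; rewrite dot_sumr.
under eq_bigr do rewrite cb//.
by rewrite -mulr_suml a1 mul1r.
Qed.

Lemma aff_hull_line A x y (t : R) : A x -> A y -> aff_hull A (x + t *: (x - y)).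
Proof.
move=> Ax Ay; exists 2%N, (fun i => if i == 0 then 1 + t else - t).
exists (fun i => if i == 0 then x else y); split => [i||].
- by case: ifP.
- by rewrite big_ord_recl big_ord1/= addrK.
- by rewrite big_ord_recl big_ord1/= scalerDl scale1r scaleNr scalerBr addrA.
Qed.

Lemma conv_hull_dot_le A c (b : R) y :
  (forall x, A x -> dot c x <= b) -> conv_hull A y -> dot c y <= b.
Proof.
move=> cb.
exact: (@smallest_sub V _ A _ (convex_dot_le (a := c) (b := b)) cb).
Qed.

Lemma argmax_const P d x y : argmax P d x -> argmax P d y -> dot d x = dot d y.
Proof. by move=> [Px dx] [Py dy]; apply/eqP; rewrite eq_le dx ?dy. Qed.

(** Let [c] expose [F]. Since [d] is relatively interior, the segment from [c] to [d] can be
    prolonged a little beyond [d] inside the normal cone. A maximiser [x] of [d] ties with [F] for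
    [d], so maximality of [F] for the prolonged vector forces [x] to be maximal for [c]. *)
Lemma face_relint_normal_cone P F d :
  face P F -> relint (normal_cone P F) d -> F = argmax P d.
Proof.
move=> [[y0 Fy0] [c FE]] [Nd near_d]; apply/seteqP; split => [x /Nd//|x dx].
have Nc : normal_cone P F c by rewrite /normal_cone/= -FE.
have [e e0 /(_ (e / 2))] := nbhs_line (d - c) near_d.
have e2 : 0 < e / 2 by rewrite divr_gt0.
rewrite gtr0_norm// ltr_pdivrMr// ltr_pMr// ltr1n => /(_ isT).
move=> /(_ (aff_hull_line _ Nd Nc)) /(_ y0 Fy0) [Py0 /(_ x dx.1)].
have dxy0 : dot d x = dot d y0 by exact: argmax_const dx (Nd _ Fy0).
rewrite !dotDl !dotZl !dotBl dxy0 lerD2l ler_pM2l// lerD2l lerN2 => cxy.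
rewrite FE; split; first exact: dx.1.
by move=> y Py; rewrite (le_trans _ cxy)//; have [_ ->] := Nc _ Fy0.
Qed.

Context (m : nat) (a : 'I_m -> V) (b : 'I_m -> R).
Local Notation P := [set x | forall i, dot (a i) x <= b i].

(** If the supremum were not attained, adding the constraint [sup D <= dot c x] would make the
    system infeasible. The Farkas certificate then bounds [dot c] on [P] by [sup D - t^-1], strictly
    below the supremum. *)
Lemma polyhedron_max_attained c (M : R) :
  P !=set0 -> (forall x, P x -> dot c x <= M) -> argmax P c !=set0.
Proof.
move=> [x0 Px0] cM; pose D := dot c @` P.
have supD : has_sup D.
  by split; [exists (dot c x0), x0|exists M => _ [x Px <-]; exact: cM].
have leD x : P x -> dot c x <= sup D.
  by move=> Px; apply: ub_le_sup; [exact: supD.2|exists x].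
apply: contrapT => noM.
pose a' (i : 'I_m + unit) := if i is inl j then a j else - c.
pose b' (i : 'I_m + unit) := if i is inl j then b j else - sup D.
have [x ax|z az|s [s0]] := @farkas_affine R k _ a' b' 0 (-1).
- exfalso; apply: noM; exists x.
  have Px : P x by move=> i; exact: ax (inl i).
  split=> // y Py; rewrite (le_trans (leD _ Py))//.
  by have := ax (inr tt); rewrite /= dotNl lerN2.
- by rewrite dot0l.
rewrite !sum_inr_tt/= scalerN => /esym/eqP; rewrite subr_eq0 => /eqP sE sb.
set t := s (inr tt) in sE sb.
have le_t x : P x -> t * dot c x <= t * sup D - 1.
  move=> Px; rewrite -dotZl -sE dot_suml.
  have : \sum_i s (inl i) * dot (a i) x <= \sum_i s (inl i) * b i.
    by apply: ler_sum => i _; rewrite ler_wpM2l// Px.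
  by move: sb; rewrite mulrN; lra.
(* With [t = 0] the certificate would not involve the added constraint and would contradict
   feasibility of [x0]. *)
have : 0 < t.
  rewrite lt_neqAle s0 andbT eq_sym; apply/eqP => t0.
  by have := le_t _ Px0; rewrite t0 !mul0r; lra.
move=> t0; have : sup D <= sup D - t^-1.
  apply: ge_sup; first by exists (dot c x0), x0.
  move=> _ [x Px <-]; rewrite -(ler_pM2l t0) mulrBr divff ?gt_eqF//.
  exact: le_t.
by have : 0 < t^-1 by [rewrite invr_gt0]; lra.
Qed.

(** The maximal face is [P] with the extra constraint [M <= dot d x], and there [- a i] is at most
    [- b i]. The Farkas multiplier of the extra constraint is the constant [t]: away from the face,
    the slack of an active row is at most [t] times the loss in [d]. *)
Lemma argmax_active_le d i : (exists x, argmax P d x) ->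
  (forall y, argmax P d y -> dot (a i) y = b i) ->
  exists2 t, 0 <= t & forall x y, P x -> argmax P d y ->
    dot (a i) (y - x) <= t * dot d (y - x).
Proof.
move=> [y0 dy0] ai; pose M := dot d y0.
pose a' (i : 'I_m + unit) := if i is inl j then a j else - d.
pose b' (i : 'I_m + unit) := if i is inl j then b j else - M.
have aP x : (forall j, dot (a' j) x <= b' j) -> argmax P d x.
  move=> ax; have Px : P x by move=> j; exact: ax (inl j).
  split=> // y Py; rewrite (le_trans (dy0.2 _ Py))//.
  by have := ax (inr tt); rewrite /= dotNl lerN2.
have [[j|[]]|x /aP/ai|s [s0]] :=
  @farkas_affine_feasible R k _ a' b' (- a i) y0 (- b i).
- exact: dy0.1.
- by rewrite /= dotNl.
- by rewrite dotNl => ->.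
rewrite !sum_inr_tt/= scalerN => aE sb; set t := s (inr tt) in aE sb.
exists t => [|x y Px dy]; first exact: s0.
rewrite !dotBr ai// (argmax_const dy dy0) -/M.
have : dot (- a i) x = - dot (a i) x by rewrite dotNl.
rewrite aE dotBl dotZl dot_suml => ax.
have : \sum_j s (inl j) * dot (a j) x <= \sum_j s (inl j) * b j.
  by apply: ler_sum => j _; rewrite ler_wpM2l// Px.
by move: sb ax; rewrite mulrN mulrBr; lra.
Qed.

(** Complementary slackness: the terms [s j * (b j - dot (a j) y)] are nonnegative, and since [c] is
    maximal at [y] their sum is at most zero. *)
Lemma normal_cone_span F c : F !=set0 -> normal_cone P F c ->
  exists2 s : 'I_m -> R, c = \sum_i s i *: a i &
    forall i y, F y -> s i != 0 -> dot (a i) y = b i.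
Proof.
move=> [y0 Fy0] Nc; have [Py0 cy0] := Nc _ Fy0.
have [s [s0 cE sb]] := farkas_affine_feasible Py0 cy0.
exists s => // i y Fy si; have [Py cy] := Nc _ Fy.
have cyy0 : dot c y = dot c y0 by apply: argmax_const; exact: Nc.
have s_ge0 j : 0 <= s j * (b j - dot (a j) y).
  by rewrite mulr_ge0// subr_ge0 Py.
have : \sum_j s j * (b j - dot (a j) y) == 0.
  rewrite eq_le sumr_ge0 ?andbT//.
  under eq_bigr do rewrite mulrBr.
  by rewrite sumrB -dot_suml -cE subr_le0 cyy0.
rewrite psumr_eq0// => /allP/(_ i (mem_index_enum _)).
by rewrite mulf_eq0 (negPf si) subr_eq0 => /eqP.
Qed.

(* The inactive rows are zeroed; by complementary slackness the row space of
   [A] then contains the normal cone, which bounds the coefficients of a small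
   displacement inside the affine hull. *)
Lemma relint_normal_cone_argmax d : argmax P d !=set0 ->
  relint (normal_cone P (argmax P d)) d.
Proof.
move=> F0; split; first by [].
set F := argmax P d in F0 *.
pose act i := `[< forall y, F y -> dot (a i) y = b i >].
pose A : 'M[R]_(m, k) := \matrix_(i < m) (if act i then a i else 0).
have NA c : normal_cone P F c -> (c <= A)%MS.
  move=> /(normal_cone_span F0)[s -> sact]; apply: summx_sub => i _.
  have [->|si] := eqVneq (s i) 0; first by rewrite scale0r sub0mx.
  apply: scalemx_sub; have := row_sub i A; rewrite rowK ifT//.
  by apply/asboolP => y Fy; exact: sact.
have affA c : aff_hull (normal_cone P F) c -> (c <= A)%MS.
  move=> [n [u [x [Nx _ ->]]]]; apply: summx_sub => i _.
  by apply/scalemx_sub/NA.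
(* Moving off the face costs row [i] at most [t i] times what it costs [d]; a zeroed row takes
   [t i = 0]. *)
have /choice[t tP] : forall i, exists t, 0 <= t /\ forall x y, P x -> F y ->
    0 <= dot (row i A) (y - x) <= t * dot d (y - x).
  move=> i; rewrite rowK; case: (boolP (act i)) => [/asboolP ai|_].
    have [t t0 tP] := argmax_active_le F0 ai; exists t; split => // x y Px Fy.
    by rewrite tP// dotBr ai// subr_ge0 Px.
  exists 0; split=> // x y Px Fy.
  by rewrite dot0l mul0r lexx.
(* The coefficients of [d' - d] over the rows of [A] are linear functionals given by the columns of
   the pseudo-inverse, hence small near [d]. *)
pose q i : V := (col i (pinvmx A))^T.
have qE d' i : ((d' - d) *m pinvmx A) 0 i = dot (q i) (d' - d).
  rewrite dotC /dot mxE; apply: eq_bigr => j _; congr (_ * _).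
  by rewrite !mxE.
(* Chosen so that [e * \sum_i t i <= 1]: the total perturbation then cannot exceed [dot d (y - x)].
   The summand 1 keeps the denominator positive when all [t i] vanish. *)
pose e := (1 + \sum_i t i)^-1.
have t1 : 0 < 1 + \sum_i t i.
  by rewrite ltr_pwDl// sumr_ge0// => i _; exact: (tP i).1.
have : \forall d' \near d, forall i, `|dot (q i) (d' - d)| < e.
  apply: (@filter_forall V 'I_m
    (fun i d' => `|dot (q i) (d' - d)| < e) (nbhs d) (nbhs_filter d)) => i.
  have e0 : 0 < e by rewrite invr_gt0.
  have := @near_ltr_dot _ _ (q i) d (dot (q i) d + e); rewrite ltrDl => /(_ e0).
  have := @near_ltr_dot _ _ (- q i) d (dot (- q i) d + e).
  rewrite ltrDl => /(_ e0).
  apply: filterS2 => d'; rewrite dotBr !dotNl ltr_norml; lra.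
apply: filterS => d' small affd' y Fy.
have Nd : normal_cone P F d by [].
have d'E : d' = d + \sum_i ((d' - d) *m pinvmx A) 0 i *: row i A.
  have subA : (d' - d <= A)%MS.
    apply: addmx_sub; first exact: affA.
    by rewrite -scaleN1r; apply: scalemx_sub; exact: NA.
  rewrite -[X in _ + X]mulmx_sum_row (mulmxKpV subA).
  by rewrite addrC subrK.
split=> [|x Px]; first exact: Fy.1.
rewrite -subr_ge0 -dotBr d'E dotDl dot_suml.
have dxy : 0 <= dot d (y - x) by rewrite dotBr subr_ge0; exact: Fy.2.
suff : - dot d (y - x) <=
    \sum_i ((d' - d) *m pinvmx A) 0 i * dot (row i A) (y - x) by lra.
apply: (@le_trans _ _ (\sum_i - (e * (t i * dot d (y - x))))).
  rewrite sumrN lerN2 -mulr_sumr -mulr_suml mulrA ler_piMl//.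
  by rewrite /e mulrC ler_pdivrMr// mul1r lerDr.
apply: ler_sum => i _; rewrite qE.
have /andP[g0 gt] := (tP i).2 _ _ Px Fy; have := small i.
rewrite ltr_norml => /andP[si _].
rewrite (@le_trans _ _ (- e * dot (row i A) (y - x)))//.
  by rewrite mulNr lerN2 ler_wpM2l// invr_ge0 ltW.
by rewrite ler_wpM2r// ltW.
Qed.

(** On the affine hull of the face, [dot d] and the active rows keep their constant values; the
    remaining rows are strict at [z], which is an open condition. *)
Lemma relint_argmax d z : argmax P d z ->
  (forall i, (forall y, argmax P d y -> dot (a i) y = b i) \/
             dot (a i) z < b i) ->
  relint (argmax P d) z.
Proof.
move=> dz az; split=> //.
have : \forall y \near z, forall i, dot (a i) z < b i -> dot (a i) y < b i.
  apply: (@filter_forall V 'I_m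
    (fun i y => dot (a i) z < b i -> dot (a i) y < b i)
    (nbhs z) (nbhs_filter z)) => i.
  have [azi|_] := ltP (dot (a i) z) (b i).
    by have := near_ltr_dot azi; apply: filterS.
  exact: nearW.
apply: filterS => y yb affy.
have dyz : dot d y = dot d z.
  by apply: (aff_hull_dot _ affy) => x dx; exact: argmax_const dx dz.
split=> [i|x Px]; last by rewrite dyz dz.2.
have [ai|/yb/ltW//] := az i.
by rewrite (aff_hull_dot ai affy).
Qed.

End Polyhedron.

(** * Exponential families *)

Section Atoms.
Set Implicit Arguments.
Unset Strict Implicit.
Context {R : realType} {k : nat}.
Local Notation V := 'rV[R]_k.
Local Notation T := (borel_rV R k).
Context (nu : {measure set T -> \bar R}).
Implicit Types (x theta c d : V) (F D : set T).

Lemma measurable_closed (A : set V) :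
  closed A -> (measurable : set (set T)) A.
Proof.
move=> cA; rewrite -(setCK A); apply: measurableC.
by apply: sub_sigma_algebra; exact: closed_openC.
Qed.

Lemma measurable_point x : (measurable : set (set T)) [set x].
Proof.
apply: measurable_closed; apply: accessible_closed_set1.
exact/hausdorff_accessible/norm_hausdorff.
Qed.

(** A null set contains no atom. This converts almost-everywhere convergence into convergence at
    each atom. *)
Lemma ae_atom (Q : V -> Prop) x : atoms nu x -> {ae nu, forall x, Q x} -> Q x.
Proof.
move=> nux [N [mN N0 QN]]; apply: contrapT => nQx; move: nux.
rewrite /atoms/= ltNge => /negP; apply; rewrite -N0.
apply: le_measure; rewrite ?inE//; first exact: measurable_point.
by move=> _ ->; exact: QN.
Qed.

Lemma Rintegral_atom_ge D (g : T -> R) (x : T) : measurable D -> D x ->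
  (forall y, D y -> 0 <= g y) -> nu.-integrable D (EFin \o g) ->
  (nu [set x] < +oo)%E ->
  g x * fine (nu [set x]) <= \int[nu]_(y in D) g y.
Proof.
move=> mD Dx g0 ig nux.
have nufin : nu [set x] \is a fin_num by rewrite ge0_fin_numE.
rewrite -lee_fin EFinM fineK// /Rintegral fineK; last first.
  exact: integrable_fin_num ig.
rewrite -integral_cst; last exact: measurable_point.
apply: (@le_trans _ _ (\int[nu]_(y in [set x]) (g y)%:E)%E).
  rewrite le_eqVlt; apply/orP; left; apply/eqP.
  by apply: eq_integral => y; rewrite inE => ->.
apply: ge0_subset_integral => //.
- exact: measurable_point.
- exact: measurable_int ig.
- by move=> _ ->.
Qed.

End Atoms.

Section ExponentialFamily.
Set Implicit Arguments.
Unset Strict Implicit.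
Context {R : realType} {k : nat}.
Local Notation V := 'rV[R]_k.
Local Notation T := (borel_rV R k).
Context (nu : {measure set T -> \bar R}).
Implicit Types (x theta c d : V) (F D : set T).

Local Notation weight theta := (fun x : T => expR (dot (x : V) theta)).
Local Notation Zint F theta := (\int[nu]_(x in F) expR (dot (x : V) theta)).

Lemma measurable_weight theta D : measurable_fun D (weight theta).
Proof.
apply: measurable_funTS; apply: measurableT_comp => //.
exact: measurable_dot.
Qed.

Lemma integrable_weight theta : natural_params nu theta ->
  nu.-integrable setT (EFin \o weight theta).
Proof.
move=> wty; apply/integrableP; split.
  by apply/measurable_EFinP; exact: measurable_weight.
by under eq_integral do rewrite /= ger0_norm ?expR_ge0//.
Qed.

(** The weight is a positive constant on a singleton, so an atom of infinite mass would make the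
    partition integral infinite. *)
Lemma atom_lty theta x : natural_params nu theta -> (nu [set x] < +oo)%E.
Proof.
move=> /integrable_weight iw; rewrite ltey; apply/eqP => nuoo.
have : (\int[nu]_(y in [set x]) (weight theta y)%:E)%E \is a fin_num.
  apply: integrable_fin_num; first exact: measurable_point.
  by apply: (integrableS measurableT) iw => //; exact: measurable_point.
rewrite (_ : integral _ _ _ = (weight theta x)%:E * nu [set x])%E.
  by rewrite nuoo gt0_muley// lte_fin expR_gt0.
rewrite -integral_cst; last exact: measurable_point.
by apply: eq_integral => y; rewrite inE => ->.
Qed.

Lemma Zint_gt0 theta F x : natural_params nu theta -> measurable F ->
  atoms nu x -> F x -> 0 < Zint F theta.
Proof.
move=> Nt mF nux Fx.
apply: lt_le_trans (Rintegral_atom_ge mF Fx _ _ (atom_lty x Nt)).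
- by rewrite mulr_gt0 ?expR_gt0// fine_gt0// nux (atom_lty _ Nt).
- by move=> y _; exact: expR_ge0.
- by apply: integrableS (integrable_weight Nt).
Qed.

(* [|t| <= e^t + e^-t] with [t = <x, u c>] for small [u]. *)
Lemma integrable_dot_weight theta c : nbhs theta (natural_params nu) ->
  nu.-integrable setT
    (EFin \o (fun x : T => dot (x : V) c * expR (dot (x : V) theta))).
Proof.
move=> /(nbhs_line c)[e e0 Ne].
have e2 : 0 < e / 2 by rewrite divr_gt0.
have e2e : e / 2 < e by rewrite ltr_pdivrMr// ltr_pMr// ltr1n.
have ip : natural_params nu (theta + (e / 2) *: c).
  by apply: Ne; rewrite gtr0_norm.
have im : natural_params nu (theta + (- (e / 2)) *: c).
  by apply: Ne; rewrite normrN gtr0_norm.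
have := integrableZl measurableT (e / 2)^-1
  (integrableD measurableT (integrable_weight ip) (integrable_weight im)).
apply: le_integrable => //.
  apply/measurable_EFinP; apply: measurable_funM; first exact: measurable_dot.
  exact: measurable_weight.
move=> x _.
change (`|dot x c * expR (dot x theta)|%:E <= `|(e / 2)^-1 *
  (expR (dot x (theta + (e / 2) *: c)) +
   expR (dot x (theta + (- (e / 2)) *: c)))|%:E)%E.
rewrite lee_fin !dotDr !dotZr mulNr.
set t := e / 2 * dot x c; set w := dot x theta.
rewrite !expRD -mulrDr normrM (ger0_norm (expR_ge0 _)).
rewrite [leRHS]ger0_norm; last first.
  by rewrite !mulr_ge0 ?addr_ge0 ?expR_ge0// invr_ge0 ltW.
rewrite mulrCA [leLHS]mulrC ler_wpM2l ?expR_ge0//.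
rewrite -(ler_pM2l e2) mulVKf ?gt_eqF// -[X in X * _](gtr0_norm e2) -normrM -/t.
have := expR_ge1Dx t; have := expR_ge1Dx (- t).
have := expR_gt0 t; have := expR_gt0 (- t).
by rewrite ler_norml; lra.
Qed.

Lemma face_densityE theta F x : 0 < Zint F theta -> F x ->
  face_density nu F theta x = expR (dot x theta) / Zint F theta.
Proof.
by move=> Z0 Fx; rewrite /face_density mem_set// expRB lnK.
Qed.

(** Taking [setT] for the face recovers the unrestricted family, so formulas for face densities and
    means also serve for [density] and [mean]. *)
Lemma face_density_setT theta : face_density nu setT theta = density nu theta.
Proof. by apply/funext => x; rewrite /face_density in_setT. Qed.

Lemma face_mean_setT theta : face_mean nu setT theta = mean nu theta.
Proof. by rewrite /face_mean /mean face_density_setT. Qed.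

Lemma Rintegral_sum D (I : Type) (s : seq I) (f : I -> T -> R) : measurable D ->
  (forall i, nu.-integrable D (EFin \o f i)) ->
  \int[nu]_(x in D) (\sum_(i <- s) f i x) =
  \sum_(i <- s) \int[nu]_(x in D) f i x.
Proof.
move=> mD fi; elim: s => [|i s IH].
  rewrite big_nil; under eq_Rintegral do rewrite big_nil.
  by rewrite /Rintegral integral0.
rewrite big_cons -IH -RintegralD//.
  by apply: eq_Rintegral => x _; rewrite big_cons.
apply: (eq_integrable mD _ _ _ (integrable_sum mD s (fun i _ => fi i))) => x _.
by rewrite /= sumEFin.
Qed.

Lemma dot_face_mean theta F c : nbhs theta (natural_params nu) ->
  measurable F -> 0 < Zint F theta ->
  dot (face_mean nu F theta) c =
  (\int[nu]_(x in F) (dot (x : V) c * expR (dot (x : V) theta))) / Zint F theta.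
Proof.
move=> Nt mF Z0.
have iF i : nu.-integrable F
    (EFin \o (fun x : T => (x : V) 0 i * expR (dot (x : V) theta))).
  apply: (integrableS measurableT) => //.
  have := integrable_dot_weight (delta_mx 0 i) Nt.
  by apply: (eq_integrable measurableT) => x _; rewrite /= dot_delta.
rewrite {1}/dot.
have -> : \sum_i (face_mean nu F theta) 0 i * c 0 i =
    \sum_i (\int[nu]_(x in F)
      (c 0 i * ((x : V) 0 i * expR (dot (x : V) theta)))) / Zint F theta.
  apply: eq_bigr => i _; rewrite mxE RintegralZl// mulrC -mulrA; congr (_ * _).
  rewrite -RintegralZr//; apply: eq_Rintegral => x; rewrite inE => Fx.
  by rewrite face_densityE// mulrA.
rewrite -mulr_suml -Rintegral_sum//; last first.
  by move=> i; exact: (integrableZl mF (c 0 i) (iF i)).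
congr (_ / _); apply: eq_Rintegral => x _.
by rewrite /dot mulr_suml; apply: eq_bigr => i _; rewrite mulrA (mulrC (c 0 i)).
Qed.

Lemma face_mean_le theta F c (b : R) : nbhs theta (natural_params nu) ->
  measurable F -> 0 < Zint F theta -> (forall x, F x -> dot x c <= b) ->
  dot (face_mean nu F theta) c <= b.
Proof.
move=> Nt mF Z0 Fb; rewrite dot_face_mean// ler_pdivrMr//.
have iw := integrableS measurableT mF (@subsetT _ _)
  (integrable_weight (nbhs_singleton Nt)).
rewrite -RintegralZl//; apply: le_Rintegral => //.
- exact: integrableS measurableT mF (@subsetT _ _) (integrable_dot_weight c Nt).
- exact: (integrableZl mF b iw).
- by move=> x Fx; rewrite ler_wpM2r ?expR_ge0// Fb.
Qed.

(** The integral of the nonnegative function [b - dot x c] against the weight is at least the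
    contribution of the atom [s], which is positive. *)
Lemma face_mean_lt theta F c (b : R) s : nbhs theta (natural_params nu) ->
  measurable F -> (forall x, F x -> dot x c <= b) ->
  atoms nu s -> F s -> dot s c < b -> dot (face_mean nu F theta) c < b.
Proof.
move=> Nt mF Fb nus Fs sb.
have Nt0 := nbhs_singleton Nt; have Z0 := Zint_gt0 Nt0 mF nus Fs.
rewrite dot_face_mean// ltr_pdivrMr//.
have iw := integrableS measurableT mF (@subsetT _ _) (integrable_weight Nt0).
have id := integrableS measurableT mF (@subsetT _ _)
  (integrable_dot_weight c Nt).
rewrite -RintegralZl// -subr_gt0 -RintegralB//; last first.
  exact: (integrableZl mF b iw).
apply: lt_le_trans (Rintegral_atom_ge mF Fs _ _ (atom_lty s Nt0)).
- rewrite mulr_gt0//; first by rewrite -mulrBl mulr_gt0 ?expR_gt0// subr_gt0.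
  by rewrite fine_gt0// nus (atom_lty _ Nt0).
- by move=> y Fy; rewrite -mulrBl mulr_ge0 ?expR_ge0// subr_ge0 Fb.
- exact: (integrableB mF (integrableZl mF b iw) id).
Qed.

(* [e^<x, theta + r d> = e^(r M) * tilt theta d M r x]; the constant factor
   cancels in densities and means, and [M] is the maximum of [<., d>]. *)
Definition tilt theta d (M r : R) (x : T) : R :=
  expR (dot (x : V) theta + r * (dot (x : V) d - M)).

Lemma tiltE theta d (M r : R) x :
  tilt theta d M r x = expR (- (r * M)) * expR (dot x (theta + r *: d)).
Proof.
by rewrite -expRD /tilt dotDr dotZr mulrBr; congr expR; ring.
Qed.

Lemma Rintegral_tilt (h : T -> R) theta d (M r : R) :
  nu.-integrable setT
    (EFin \o (fun x : T => h x * expR (dot (x : V) (theta + r *: d)))) ->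
  \int[nu]_x (h x * tilt theta d M r x) =
  expR (- (r * M)) * \int[nu]_x (h x * expR (dot (x : V) (theta + r *: d))).
Proof.
move=> ih; rewrite -RintegralZl//; apply: eq_Rintegral => x _.
by rewrite tiltE mulrCA.
Qed.

Lemma Rintegral1_tilt theta d (M r : R) : natural_params nu (theta + r *: d) ->
  \int[nu]_x tilt theta d M r x = expR (- (r * M)) * Zint setT (theta + r *: d).
Proof.
move=> /integrable_weight iw; rewrite -RintegralZl//.
by apply: eq_Rintegral => x _; rewrite tiltE.
Qed.

Lemma density_tilt theta d (M r : R) x : natural_params nu (theta + r *: d) ->
  0 < Zint setT (theta + r *: d) ->
  density nu (theta + r *: d) x =
  tilt theta d M r x / \int[nu]_y tilt theta d M r y.
Proof.
move=> Nt Z0; rewrite -face_density_setT.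
rewrite (face_densityE Z0); last by [].
rewrite (Rintegral1_tilt M Nt).
rewrite tiltE.
by rewrite -mulf_div divff ?mul1r// gt_eqF ?expR_gt0.
Qed.

Lemma dot_mean_tilt theta d c (M r : R) :
  nbhs (theta + r *: d) (natural_params nu) -> 0 < Zint setT (theta + r *: d) ->
  dot (mean nu (theta + r *: d)) c =
  (\int[nu]_x (dot (x : V) c * tilt theta d M r x)) /
  \int[nu]_y tilt theta d M r y.
Proof.
move=> Nt Z0; rewrite -face_mean_setT.
rewrite (dot_face_mean c Nt measurableT Z0).
rewrite (Rintegral_tilt (h := fun x : T => dot (x : V) c)); last first.
  exact: integrable_dot_weight.
rewrite Rintegral1_tilt; last exact: nbhs_singleton.
by rewrite -mulf_div divff ?mul1r// gt_eqF ?expR_gt0.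
Qed.

Lemma cvg_expR_mulNr (r : nat -> R) (t : R) :
  r n @[n --> \oo] --> +oo -> t < 0 ->
  expR (r n * t) @[n --> \oo] --> 0.
Proof.
move=> roo t0.
have ty : (- t) * x @[x --> +oo] --> +oo.
  by apply: gt0_cvgMry; [rewrite oppr_gt0|exact: cvg_id].
have := cvg_comp _ _ (cvg_comp _ _ roo ty) (@cvgr_expR R); apply: cvg_trans.
by apply: near_eq_cvg; apply: nearW => n /=; rewrite mulNr opprK mulrC.
Qed.

Lemma cvg_rV (f : nat -> V) (l : V) :
  (forall i, f n 0 i @[n --> \oo] --> l 0 i) -> f n @[n --> \oo] --> l.
Proof.
move=> fl; apply/cvg_ballP => e e0.
have : \forall n \near \oo, forall i, ball (l 0 i) e (f n 0 i).
  apply: (@filter_forall nat 'I_k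
    (fun i n => ball (l 0 i) e (f n 0 i)) \oo _) => i.
  by move/cvg_ballP: (fl i); apply.
by apply: filterS => n fn; split=> // i j; rewrite ord1; exact: fn.
Qed.

(** * Limits of densities and means when [<., d>] attains its maximum over [P] exactly on [F] *)

Section Limit.
Context (P F : set V) (theta d : V) (M : R) (r : nat -> R).
Context (mP : (measurable : set (set T)) P) (nuP : nu (~` P) = 0%E).
Context (PM : forall x, P x -> dot x d <= M).
Context (FE : forall x, F x <-> P x /\ dot x d = M).
Context (r0 : forall n, 0 <= r n) (roo : r n @[n --> \oo] --> +oo).

Lemma cvg_tilt x : P x ->
  tilt theta d M (r n) x @[n --> \oo] --> (weight theta \_ F) x.
Proof.
move=> Px; rewrite patchE; case: ifPn => [/set_mem/FE[_ xM]|].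
  by rewrite /tilt xM subrr; under eq_fun do rewrite mulr0 addr0; exact: cvg_cst.
move=> xF; have xM : dot x d - M < 0.
  rewrite subr_lt0 lt_neqAle PM// andbT; apply/eqP => xM.
  by move/negP: xF; apply; apply/mem_set/FE.
rewrite /tilt; under eq_fun do rewrite expRD.
have : expR (dot x theta) * expR (r n * (dot x d - M)) @[n --> \oo]
    --> expR (dot x theta) * 0 by apply: cvgMl_tmp; exact: cvg_expR_mulNr.
by rewrite mulr0.
Qed.

(** Since [r n >= 0] and [dot x d <= M] on [P], the tilted weight is dominated by the weight at
    [theta]. The factor [h] will be 1 for the normalisation and a coordinate for the mean. *)
Lemma cvg_Rintegral_tilt (h : T -> R) : measurable_fun setT h ->
  nu.-integrable setT (EFin \o (fun x : T => h x * expR (dot (x : V) theta))) ->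
  (measurable : set (set T)) F ->
  \int[nu]_x (h x * tilt theta d M (r n) x) @[n --> \oo] -->
  \int[nu]_(x in F) (h x * expR (dot (x : V) theta)).
Proof.
move=> mh ih mF; rewrite Rintegral_mkcond.
have mw n : measurable_fun setT
    (EFin \o (fun x : T => h x * tilt theta d M (r n) x)).
  apply/measurable_EFinP; apply: measurable_funM => //.
  rewrite (_ : tilt _ _ _ _ = fun x : T =>
    expR (- (r n * M)) * expR (dot (x : V) (theta + r n *: d))); last first.
    by apply/funext => x; exact: tiltE.
  by apply: measurable_funM => //; exact: measurable_weight.
pose wF : T -> R := (fun x : T => h x * expR (dot (x : V) theta)) \_ F.
have mwF : measurable_fun setT (EFin \o wF).
  apply/measurable_EFinP; apply/(measurable_restrictT _ mF).
  by apply: measurable_funM; [exact: measurable_funTS|exact: measurable_weight].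
have aeP (Q : T -> Prop) : (forall x, P x -> Q x) -> {ae nu, forall x, Q x}.
  move=> PQ; exists (~` P); split => //; first exact: measurableC.
  by move=> x nQx Px; apply: nQx; exact: PQ.
have [||ig _] :=
  dominated_convergence measurableT mw mwF _ (integrable_abse ih) _.
- apply: aeP => x Px _; apply: cvg_EFin; first exact: nearW.
  have hF : h x * (weight theta \_ F) x = wF x.
    by rewrite /wF !patchE; case: ifP => // _; exact: (mulr0 (h x)).
  by rewrite -hF; apply: cvgMl_tmp; exact: cvg_tilt.
- apply: aeP => x Px n _; rewrite /= lee_fin !normrM ler_wpM2l//.
  rewrite !ger0_norm ?expR_ge0// ler_expR gerDl mulr_ge0_le0//.
  by rewrite subr_le0 PM.
rewrite -[X in _ --> X](fineK (integrable_fin_num measurableT ig)).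
by move=> /fine_cvg.
Qed.

Context (mF : (measurable : set (set T)) F).
Context (Nt : nbhs theta (natural_params nu)).
Context (Nn : forall n, nbhs (theta + r n *: d) (natural_params nu)).
Context (s : V) (nus : atoms nu s) (Fs : F s).

Let Zn_gt0 n : 0 < Zint setT (theta + r n *: d).
Proof. exact: Zint_gt0 (nbhs_singleton (Nn n)) measurableT nus I. Qed.

Let ZF_gt0 : 0 < Zint F theta.
Proof. exact: Zint_gt0 (nbhs_singleton Nt) mF nus Fs. Qed.

Lemma cvg_Rintegral1_tilt :
  \int[nu]_x tilt theta d M (r n) x @[n --> \oo] --> Zint F theta.
Proof.
have := @cvg_Rintegral_tilt (fun=> 1) (measurable_cst _).
have -> : EFin \o (fun x : T => 1 * expR (dot (x : V) theta)) =
    EFin \o weight theta.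
  by apply/funext => x /=; rewrite mul1r.
move=> /(_ (integrable_weight (nbhs_singleton Nt)) mF).
rewrite (_ : (fun x : T => 1 * expR (dot (x : V) theta)) = weight theta);
    last first.
  by apply/funext => x; rewrite mul1r.
apply: cvg_trans; apply: near_eq_cvg; apply: nearW => n.
by apply: eq_Rintegral => x _; rewrite mul1r.
Qed.

Lemma cvg_density x : P x ->
  density nu (theta + r n *: d) x @[n --> \oo] --> face_density nu F theta x.
Proof.
move=> Px; have -> : face_density nu F theta x =
    (weight theta \_ F) x / Zint F theta.
  rewrite patchE; case: ifPn => [/set_mem Fx|xF].
    by rewrite (face_densityE ZF_gt0).
  by rewrite /face_density (negPf xF); exact/esym/(mul0r (Zint F theta)^-1).
rewrite (_ : (fun n => _) =
    fun n => tilt theta d M (r n) x / \int[nu]_y tilt theta d M (r n) y);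
    last first.
  apply/funext => n.
  exact: (density_tilt M x (nbhs_singleton (Nn n)) (Zn_gt0 n)).
apply: cvgM; first exact: cvg_tilt.
by apply: cvgV; [rewrite gt_eqF|exact: cvg_Rintegral1_tilt].
Qed.

Lemma cvg_mean :
  mean nu (theta + r n *: d) @[n --> \oo] --> face_mean nu F theta.
Proof.
apply: cvg_rV => i; rewrite -dot_delta (dot_face_mean _ Nt mF ZF_gt0).
rewrite (_ : (fun n => _) = fun n =>
    (\int[nu]_x (dot (x : V) (delta_mx 0 i) * tilt theta d M (r n) x)) /
    \int[nu]_y tilt theta d M (r n) y); last first.
  apply/funext => n.
  by rewrite -dot_delta (dot_mean_tilt _ M (Nn n) (Zn_gt0 n)).
apply: cvgM; last by apply: cvgV; [rewrite gt_eqF|exact: cvg_Rintegral1_tilt].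
apply: cvg_Rintegral_tilt mF; first exact: measurable_dot.
exact: integrable_dot_weight.
Qed.

End Limit.

(* With [M = L] and an atom [s] beyond level [L + 1], the normalisation of the
   tilted measure grows like [e^(r n)], while the part of the integral of
   [<x, d> - L] lying below level [L] stays bounded. *)
Lemma dot_mean_cvg_pinfty theta d (r : nat -> R) :
  (forall n, 0 <= r n) -> r n @[n --> \oo] --> +oo ->
  nbhs theta (natural_params nu) ->
  (forall n, nbhs (theta + r n *: d) (natural_params nu)) ->
  (forall L : R, exists2 s, atoms nu s & L < dot s d) ->
  dot (mean nu (theta + r n *: d)) d @[n --> \oo] --> +oo.
Proof.
move=> r0 roo Nt Nn unb; apply/cvgryPge => B.
(* The margin 1 in [L] absorbs a quotient that will be at least -1. The atom lies one further unit
   up, so its tilt is at least [expR (r n)] times its weight at [theta]. *)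
pose L := B + 1; have [s nus Ls] := unb (L + 1).
have Nt0 := nbhs_singleton Nt.
have nus_lty := atom_lty s Nt0.
pose kappa := expR (dot s theta) * fine (nu [set s]).
have kappa0 : 0 < kappa by rewrite mulr_gt0 ?expR_gt0// fine_gt0// nus nus_lty.
pose h (x : T) := dot (x : V) d - L.
have ih th : nbhs th (natural_params nu) ->
    nu.-integrable setT (EFin \o (fun x : T => h x * expR (dot (x : V) th))).
  move=> Nth; have := integrableB measurableT (integrable_dot_weight d Nth)
    (integrableZl measurableT L (integrable_weight (nbhs_singleton Nth))).
  apply: (eq_integrable measurableT) => x _.
  by rewrite /= /h mulrBl EFinB.
(* A bound, uniform in [n], for the negative part of the tilted integral of [h]: where [h] is
   negative, tilting only lowers the weight. *)
pose C := \int[nu]_x `|h x * expR (dot (x : V) theta)|.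
have : \forall n \near \oo, C / kappa <= r n by move/cvgryPge : roo; exact.
apply: filterS => n Cr.
have Nn0 := nbhs_singleton (Nn n).
have Zn0 : 0 < Zint setT (theta + r n *: d).
  exact: Zint_gt0 Nn0 measurableT nus I.
pose Z := \int[nu]_x tilt theta d L (r n) x.
have tilt0 x : 0 <= tilt theta d L (r n) x by exact: expR_ge0.
have itilt : nu.-integrable setT (EFin \o tilt theta d L (r n)).
  have := integrableZl measurableT (expR (- (r n * L))) (integrable_weight Nn0).
  apply: (eq_integrable measurableT) => x _.
  by rewrite /= tiltE.
have ihtilt : nu.-integrable setT
    (EFin \o (fun x : T => h x * tilt theta d L (r n) x)).
  have := integrableZl measurableT (expR (- (r n * L))) (ih _ (Nn n)).
  apply: (eq_integrable measurableT) => x _.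
  by rewrite /= tiltE mulrCA.
(* The atom alone contributes at least [kappa * expR (r n)], and [expR (r n) >= 1 + r n] exceeds
   [C / kappa]. *)
have Z_ge : C <= Z.
  have := Rintegral_atom_ge measurableT I (fun x _ => tilt0 x) itilt nus_lty.
  apply: le_trans; rewrite /tilt expRD mulrAC -/kappa.
  move: Cr; rewrite ler_pdivrMr// => /le_trans; apply.
  rewrite mulrC ler_wpM2l ?(ltW kappa0)//.
  apply: (@le_trans _ _ (1 + r n)); first by rewrite lerDr.
  apply: le_trans (expR_ge1Dx (r n)) _; rewrite ler_expR.
  by apply: ler_peMr (r0 n) _; lra.
have Z0 : 0 < Z by rewrite /Z Rintegral1_tilt// mulr_gt0 ?expR_gt0.
have h_ge : - C <= \int[nu]_x (h x * tilt theta d L (r n) x).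
  have iabs := integrable_norm (ih _ Nt).
  rewrite -mulN1r -RintegralZl//; apply: le_Rintegral => //.
    exact: (integrableZl measurableT (-1) iabs).
  move=> x _; rewrite mulN1r; have [hx|hx] := leP 0 (h x).
    by rewrite (@le_trans _ _ 0) ?oppr_le0// mulr_ge0.
  rewrite normrM (ltr0_norm hx) mulNr opprK ler_wnM2l ?(ltW hx)//.
  rewrite [leRHS]ger0_norm ?expR_ge0// ler_expR gerDl.
  exact: mulr_ge0_le0 (r0 n) (ltW hx).
have -> : dot (mean nu (theta + r n *: d)) d =
    L + (\int[nu]_x (h x * tilt theta d L (r n) x)) / Z.
  rewrite (dot_mean_tilt _ L (Nn n) Zn0) -/Z.
  have -> : \int[nu]_x (dot (x : V) d * tilt theta d L (r n) x) =
      \int[nu]_x (h x * tilt theta d L (r n) x + L * tilt theta d L (r n) x).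
    by apply: eq_Rintegral => x _; rewrite /h mulrBl subrK.
  rewrite RintegralD//; last exact: (integrableZl measurableT L itilt).
  by rewrite RintegralZl// mulrDl mulfK ?gt_eqF// addrC.
suff : -1 <= (\int[nu]_x (h x * tilt theta d L (r n) x)) / Z by rewrite /L; lra.
by rewrite ler_pdivlMr// mulN1r (le_trans _ h_ge)// lerN2.
Qed.

End ExponentialFamily.

(** * Convex hulls of atoms and the position of face means *)

Section Faces.
Set Implicit Arguments.
Unset Strict Implicit.
Context {R : realType} {k : nat}.
Local Notation V := 'rV[R]_k.
Implicit Types (x y c d : V) (F P S : set V).

Lemma closed_argmax P c : closed P -> closed (argmax P c).
Proof.
move=> cP; have [->|/set0P[y0 cy0]] := eqVneq (argmax P c) set0.
  exact: closed0.
rewrite (_ : argmax P c = P `&` [set x | dot (- c) x <= - dot c y0]).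
  by apply: closedI => //; exact: closed_dot_le.
apply/seteqP; split => x /=; rewrite dotNl lerN2.
  by move=> cx; split; [exact: cx.1|rewrite (argmax_const cy0 cx)].
by move=> [Px cyx]; split=> // y /cy0.2/le_trans; apply.
Qed.

(** A closed half-space containing [S] contains its hull. Through (A3) this produces atoms strictly
    beyond a given level. *)
Lemma conv_hull_dot_gt S c (b : R) y : conv_hull S y -> b < dot c y ->
  exists2 s, S s & b < dot c s.
Proof.
move=> Sy by_; apply: contrapT => noS; move: by_; rewrite ltNge => /negP; apply.
apply: conv_hull_dot_le Sy => x Sx; rewrite leNgt; apply/negP => bx.
by apply: noS; exists x.
Qed.

Lemma conv_hull_neq0 S y : conv_hull S y -> S !=set0.
Proof.
(* The zero functional exceeds the level -1 everywhere, so some point of [S] is obtained without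
   further condition. *)
move=> /(@conv_hull_dot_gt S 0 (-1)); rewrite dot0l ltrN10.
by move=> /(_ isT)[s Ss _]; exists s.
Qed.

Lemma sub_conv_hull S : S `<=` conv_hull S.
Proof. exact: sub_gen_smallest. Qed.

Lemma convex_conv_hull S : convex_set (conv_hull S).
Proof.
move=> x y l /set_mem Sx /set_mem Sy; apply/mem_set => B BS.
by apply/set_mem/BS.1; apply/mem_set; [exact: Sx|exact: Sy].
Qed.

Context (nu : {measure set (borel_rV R k) -> \bar R}).

Lemma atoms_convex_support : atoms nu `<=` convex_support nu.
Proof.
apply: subset_trans (@subset_closure _ _).
apply: subset_trans (@sub_conv_hull _).
exact: subset_closure.
Qed.

Lemma convex_support_null :
  nu (~` supp nu) = 0%E -> nu (~` convex_support nu) = 0%E.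
Proof.
move=> nu0; apply/eqP; rewrite eq_le measure_ge0 andbT -nu0.
apply: le_measure; rewrite ?inE.
- by apply: measurableC; apply: measurable_closed; exact: (@closed_closure V).
- by apply: measurableC; apply: measurable_closed; exact: (@closed_closure V).
apply: subsetC; apply: subset_trans (@subset_closure _ _).
exact: sub_conv_hull.
Qed.

(** A row not active on all of [F] is strict at some atom in [F], because atoms generate [F]; that
    atom makes the row strict at the mean. *)
Lemma face_mean_relint (P F : set V) m (a : 'I_m -> V) (b : 'I_m -> R) theta d :
  P = [set x | forall i, dot (a i) x <= b i] -> closed P ->
  F = argmax P d -> F !=set0 ->
  (exists2 S, S `<=` atoms nu & F = conv_hull S) ->
  nbhs theta (natural_params nu) -> relint F (face_mean nu F theta).
Proof.
move=> PE cP FE [y0 Fy0] [S nuS FS] Nt.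
have mF : (measurable : set (set (borel_rV R k))) F.
  by apply: measurable_closed; rewrite FE; exact: closed_argmax.
have [s Ss] : S !=set0 by apply: (@conv_hull_neq0 _ y0); rewrite -FS.
have SF : S `<=` F by rewrite FS; exact: sub_conv_hull.
have Z0 := Zint_gt0 (nbhs_singleton Nt) mF (nuS _ Ss) (SF _ Ss).
have mean_le c (M : R) : (forall x, F x -> dot c x <= M) ->
    dot c (face_mean nu F theta) <= M.
  by move=> cM; rewrite dotC face_mean_le// => x Fx; rewrite dotC cM.
have dF x : F x -> argmax P d x by rewrite FE.
have dmean : dot d (face_mean nu F theta) = dot d y0.
  apply/eqP; rewrite eq_le mean_le => [/=|x Fx]; last first.
    by rewrite (argmax_const (dF _ Fx) (dF _ Fy0)).
  rewrite -lerN2 -dotNl mean_le// => x Fx.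
  by rewrite dotNl (argmax_const (dF _ Fx) (dF _ Fy0)).
have ab x : F x -> forall i, dot (a i) x <= b i.
  by move=> /dF[+ _] i; rewrite PE; apply.
rewrite [X in relint X]FE PE; apply: relint_argmax.
  split=> [i|x Px].
    by apply: mean_le => x Fx; exact: ab.
  by rewrite dmean; apply: (dF _ Fy0).2; rewrite PE.
move=> i; rewrite -PE -FE.
have [aF|] := pselect (forall y, F y -> dot (a i) y = b i); first by left.
move=> /existsNP[y /not_implyP[Fy /eqP ay]]; right.
have {}ay : - b i < dot (- a i) y.
  by rewrite dotNl ltrN2 lt_neqAle ay ab.
have [|t St] := @conv_hull_dot_gt S (- a i) (- b i) y _ ay.
  by rewrite -FS.
rewrite dotNl ltrN2 => at_; rewrite dotC.
apply: (face_mean_lt Nt mF _ (nuS _ St) (SF _ St)); last by rewrite dotC.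
by move=> x Fx; rewrite dotC ab.
Qed.

End Faces.

(** * Case distinction on boundedness of [<., d>] over the convex support *)

Theorem corollary2p6 (R : realType) (k : nat)
    (nu : {measure set (borel_rV R k) -> \bar R}) (Theta : set 'rV[R]_k)
    (nu_supp : nu (~` supp nu) = 0%E)
    (Theta_neq0 : Theta !=set0)
    (Theta_nat : Theta `<=` natural_params nu)
    (A1 : countable (supp nu))
    (A2 : polyhedron (convex_support nu) /\
          full_dimensional (convex_support nu))
    (A3 : forall F : set 'rV[R]_k, face (convex_support nu) F ->
          exists S : set 'rV[R]_k, S `<=` atoms nu /\ F = conv_hull S)
    (A4 : open Theta)
    (theta d : 'rV[R]_k) (rho : nat -> R)
    (theta_in : Theta theta)
    (rho_ge0 : forall n, 0 <= rho n)
    (rho_oo : rho n @[n --> \oo] --> +oo)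
    (thetan_in : forall n, Theta (theta + rho n *: d)) :
  (forall F : set 'rV[R]_k, face (convex_support nu) F ->
     ([/\ {ae nu, forall x, density nu (theta + rho n *: d) x @[n --> \oo]
                              --> face_density nu F theta x},
          mean nu (theta + rho n *: d) @[n --> \oo] --> face_mean nu F theta
        & relint F (face_mean nu F theta)]
      <-> relint (normal_cone (convex_support nu) F) d)) /\
  (~ (\bigcup_(G in face (convex_support nu)) normal_cone (convex_support nu) G) d ->
     norm2 (mean nu (theta + rho n *: d)) @[n --> \oo] --> +oo).
Proof.
have [[m [a [b PE]]] fullP] := A2.
set P := convex_support nu in PE fullP A3 *.
have NTheta th : Theta th -> nbhs th (natural_params nu).
  by move=> Th; apply: filterS Theta_nat _; exact: open_nbhs_nbhs.
have Nt := NTheta _ theta_in; have Nn n := NTheta _ (thetan_in n).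
have cP : closed P by exact: closed_closure.
have mP := measurable_closed cP.
have nuP : nu (~` P) = 0%E by exact: convex_support_null.
(* Full dimension excludes the empty set: coefficients of an empty combination sum to 0, not 1. *)
have [x0 Px0] : P !=set0.
  have : aff_hull P 0 by rewrite fullP.
  move=> [[|n] [u [x [Px + _]]]]; last by exists (x ord0).
  by rewrite big_ord0 => /esym/eqP; rewrite oner_eq0.
have faceS F : face P F ->
    exists S, [/\ S `<=` atoms nu, F = conv_hull S
      & exists2 s, atoms nu s & F s].
  move=> fF; have [S [nuS FS]] := A3 _ fF; exists S; split=> //.
  have [[y0 Fy0] _] := fF; move: Fy0; rewrite [in X in X -> _]FS.
  move=> /conv_hull_neq0[s Ss]; exists s; first exact: nuS.
  by rewrite FS; exact: sub_conv_hull.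
have lim F : face P F -> F = argmax P d ->
    (forall x, P x -> density nu (theta + rho n *: d) x @[n --> \oo]
                              --> face_density nu F theta x) /\
    mean nu (theta + rho n *: d) @[n --> \oo] --> face_mean nu F theta.
  move=> fF FE; have [S [_ _ [s nus Fs]]] := faceS _ fF.
  have mF : (measurable : set (set (borel_rV R k))) F.
    by apply: measurable_closed; rewrite FE; exact: closed_argmax.
  have ds : argmax P d s by rewrite -FE.
  pose M := dot s d.
  have PM x : P x -> dot x d <= M by rewrite /M !(dotC _ d); exact: ds.2.
  have FM x : F x <-> P x /\ dot x d = M.
    rewrite /M !(dotC _ d) FE; split=> [dx|[Px xs]].
      by split; [exact: dx.1|exact: argmax_const dx ds].
    by split=> // y Py; rewrite xs; exact: ds.2.
  split=> [x Px|].
    exact: (cvg_density mP nuP PM FM rho_ge0 rho_oo mF Nt Nn nus Fs Px).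
  exact: (cvg_mean mP nuP PM FM rho_ge0 rho_oo mF Nt Nn nus Fs).
have bounded_face (M : R) :
    (forall x, P x -> dot d x <= M) -> face P (argmax P d).
  move=> PM; split; last by exists d.
  by rewrite PE; apply: (@polyhedron_max_attained _ _ _ a b d M);
    rewrite -PE//; exists x0.
have unbounded_mean : ~ (exists M : R, forall x, P x -> dot d x <= M) ->
    dot (mean nu (theta + rho n *: d)) d @[n --> \oo] --> +oo.
  move=> unb; apply: dot_mean_cvg_pinfty => // L.
  (* As a face of itself, exposed by [c = 0], [P] is a hull of atoms, so unboundedness of [<., d>]
     on [P] passes to the atoms. *)
  have fP : face P P.
    split; first by exists x0.
    exists 0; apply/seteqP; split => x; last by case.
    by move=> Px; split=> // y _; rewrite !dot0l.
  have [S [nuS PS _]] := faceS _ fP.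
  have [y Py Ly] : exists2 y, P y & L < dot d y.
    apply: contrapT => noy; apply: unb; exists L => y Py; rewrite leNgt.
    by apply/negP => Ly; apply: noy; exists y.
  have [|s Ss Ls] := @conv_hull_dot_gt _ _ S d L y _ Ly; first by rewrite -PS.
  by exists s; [exact: nuS|rewrite dotC].
split=> [F fF|noN]; last first.
  have /unbounded_mean dmean :
      ~ (exists M : R, forall x, P x -> dot d x <= M).
    move=> [M PM]; apply: noN; exists (argmax P d) => //.
    exact: bounded_face PM.
  apply/cvgryPge => B.
  (* The added 1 makes the factor positive, so that it can be cancelled from
     [(K + 1) * |B| <= (K + 1) * N]. *)
  move/cvgryPge : dmean => /(_ ((\sum_i `|d 0 i| + 1) * `|B|)).
  apply: filterS => n dB.
  have := ler_dot_norm2 d (mean nu (theta + rho n *: d)).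
  have K0 : 0 <= \sum_i `|d 0 i| by exact: sumr_ge0.
  have N0 : 0 <= norm2 (mean nu (theta + rho n *: d)) by exact: sqrtr_ge0.
  move: dB; rewrite dotC; have := ler_norm B.
  set N := norm2 _ in N0 *; set K := \sum_i _ in K0 *.
  move=> BB dB dN.
  have : (K + 1) * `|B| <= (K + 1) * N.
    by rewrite (le_trans dB)// (le_trans dN)// ler_wpM2r// lerDl.
  by rewrite ler_pM2l ?ltr_wpDl// => /(le_trans BB).
split=> [[aeF meanF _]|dN].
  (* Convergence of the means rules out the unbounded case, where their product with [d] would tend
     to infinity. *)
  have [[M PM]|/unbounded_mean dmean] :=
      pselect (exists M : R, forall x, P x -> dot d x <= M); last first.
    have : dot (mean nu (theta + rho n *: d)) d @[n --> \oo]
        --> dot (face_mean nu F theta) d.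
      exact: (cvg_comp _ _ meanF (@continuous_dot _ _ d _)).
    set l := dot _ _ => dl.
    move/cvgryPge : dmean => /(_ (l + 1)) ge1.
    have ltl1 : l < l + 1 by rewrite ltrDl ltr01.
    have lt1 : \forall n \near \oo,
        dot (mean nu (theta + rho n *: d)) d < l + 1.
      exact: (cvgr_lt l dl).
    have [n] := filter_ex (filterI lt1 ge1).
    by rewrite /= => -[]; rewrite ltNge => /negP.
  have fG := bounded_face _ PM.
  have [limG _] := lim _ fG erefl.
  have eq_dens x : atoms nu x ->
      face_density nu F theta x = face_density nu (argmax P d) theta x.
    move=> nux; have := ae_atom nux aeF.
    have := limG x (atoms_convex_support nux).
    by move=> cG cF; exact: (cvg_unique _ cF cG).
  (* Positivity of a face density detects membership, so faces whose densities agree at atoms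
     contain the same atoms; as hulls of atoms they then coincide. *)
  have mem_dens (H : set 'rV[R]_k) x : H x <-> 0 < face_density nu H theta x.
    rewrite /face_density; case: ifPn => [/set_mem Hx|xH].
      by rewrite expR_gt0.
    by rewrite ltxx; split=> // Hx; move: xH; rewrite mem_set.
  have sub_dens (H H' : set 'rV[R]_k) : face P H -> face P H' ->
      (forall x, atoms nu x ->
        face_density nu H theta x = face_density nu H' theta x) ->
      H `<=` H'.
    move=> /faceS[S [nuS HS _]] /faceS[S' [nuS' HS' _]] HH'.
    rewrite [X in X `<=` _]HS; apply: smallest_sub.
      by rewrite HS'; exact: convex_conv_hull.
    move=> x Sx; apply/mem_dens; rewrite -HH'; last exact: nuS.
    by apply/mem_dens; rewrite HS; exact: sub_conv_hull.
  have -> : F = argmax P d.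
    apply/seteqP; split; first exact: sub_dens fF fG eq_dens.
    by apply: (sub_dens _ _ fG fF) => x nux; exact/esym/eq_dens.
  rewrite PE; apply: relint_normal_cone_argmax; rewrite -PE; exact: fG.1.
have FE := face_relint_normal_cone fF dN.
have [limF meanF] := lim _ fF FE; split => //.
  exists (~` P); split => //; first exact: measurableC.
  by move=> x nx Px; apply: nx; exact: limF.
have [S [nuS FS _]] := faceS _ fF.
by apply: (face_mean_relint PE cP FE fF.1 _ Nt); exists S.
Qed.
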